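(* Let $\Xi$ be the canonical transversal of a primitive, aperiodic substitution tiling of $\mathbb{R}^d$ ($d\ge1$) with finite local complexity, such that $\Xi$ is bi-Lipschitz homeomorphic to the path space $(\Pi_\infty,\rho_w)$ of the Bratteli diagram of the substitution. Assume that in this diagram all edges are simple and that the coordinates of the Perron–Frobenius eigenvector of its adjacency matrix are pairwise distinct. Then for all $s$ large enough (i.e. there is $s_*\in\mathbb{R}$ such that for all $s>s_*$) the space $\Xi$ is bi-Hölder homeomorphic to the $\omega$-spectrum $\operatorname{Sp}_\omega(\Delta_s)\subset\mathbb{R}$ of the Laplacian $\Delta_s$.
   Context: Substitution tilings: let $\mathcal{A}$ be a finite set of prototiles, each a compact subset of $\mathbb{R}^d$ homeomorphic to a closed ball, containing $0$ in its interior, possibly labelled. A tile is a translate $p+x$ of a prototile, with puncture $x$; a patch is a set of tiles with pairwise disjoint interiors; a tiling is a patch covering $\mathbb{R}^d$. A substitution with expansion $\lambda>1$ assigns to each $p\in\mathcal{A}$ a finite patch $\omega(p)$ with union $\lambda p$, extended by $\omega(p+x)=\omega(p)+\lambda x$ and to patches by unions. $\Omega$ is the set of tilings all of whose finite subpatches are, up to translation, contained in some $\omega^n(p)$. Let $A_{pq}$ be the number of translates of $p$ in $\omega(q)$. Primitive: some power of $A$ has positive entries. Finite local complexity: for each $R>0$ there are finitely many patches of diameter $\le R$ up to translation in tilings of $\Omega$. Aperiodic: no $T\in\Omega$ has a nonzero period. $\Xi=\{T\in\Omega: 0\text{ is the puncture of a tile of }T\}$, with ultrametric $\rho(T,T')=1/(1+R)$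 for $T\neq T'$, $R$ being the supremum of the $r\ge0$ such that $T,T'$ have the same tiles meeting the closed ball of radius $r$ about $0$ ($R=0$ if none). Bratteli diagram of the substitution: vertex set $\mathcal{V}=\mathcal{A}$, edge set $\mathcal{E}$ with $A_{pq}$ edges from $p$ to $q$; level $0$ is a root $\circ$, each level $n\ge1$ is a copy of $\mathcal{V}$, there is one edge from $\circ$ to each vertex of level $1$, and a copy of $\mathcal{E}$ between levels $n$ and $n+1$ for each $n\ge1$. All edges simple means $A_{pq}\le1$. $\Pi_n$ is the set of paths of $n$ edges from the root, $\Pi=\bigcup_n\Pi_n$, $|\gamma|$ is the number of edges and $r(\gamma)$ the final vertex of $\gamma$, $\Pi_\infty$ is the set of infinite paths, $[\gamma]\subset\Pi_\infty$ is the cylinder of infinite paths with prefix $\gamma$, and $\mathrm{ext}_1(\gamma)$ is the set of edges extending $\gamma$ by one level. $\Lambda$ is the Perron–Frobenius eigenvalue of $A$ and $\nu$ the positive eigenvector $A\nu=\Lambda\nu$ with $\sum_v\nu_v=1$. Weight: $w(\gamma)=\nu_{r(\gamma)}^{1/d}\Lambda^{-|\gamma|/d}$ for $|\gamma|\ge1$, $w=1$ for the empty path; $\rho_w(x,y)=w(x\wedge y)$ for $x\ne y$ ($x\wedge y$ the longest common prefix), and $\operatorname{diam}[\gamma]=w(\gamma)$. Measure: $\mu$ is the probability measure on $\Pi_\infty$ with $\mu[\gamma]=\nu_{r(\gamma)}\Lambda^{1-|\gamma|}$ for $|\gamma|\ge1$. Laplacian: for $s>d+2$, $\Delta_s$ is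 the bounded nonnegative self-adjoint operator on $L^2(\Pi_\infty,d\mu)$ which kills constants and has, for each $\gamma\in\Pi$ with $\#\mathrm{ext}_1(\gamma)\ge2$, the eigenspace $E_\gamma$ spanned by the functions $\frac{\chi_{[\gamma e]}}{\mu[\gamma e]}-\frac{\chi_{[\gamma e']}}{\mu[\gamma e']}$, $e,e'\in\mathrm{ext}_1(\gamma)$, with eigenvalue $$\lambda_\gamma(s)=\sum_{k=0}^{n-1}\frac{\mu[\gamma_k]-\mu[\gamma_{k+1}]}{G_s(\gamma_k)}+\frac{\mu[\gamma]}{G_s(\gamma)},\qquad n=|\gamma|,$$ where $\gamma_k$ is the prefix of $\gamma$ of length $k$, $G_s(\eta)=\frac12\operatorname{diam}[\eta]^{2-s}\sum_{e\neq e'\in\mathrm{ext}_1(\eta)}\mu[\eta e]\mu[\eta e']$ (sum over ordered pairs), and terms with $\#\mathrm{ext}_1(\gamma_k)=1$ are read as $0$. $\omega$-spectrum (limit points of the eigenvalues), for $s>d+2$: $\operatorname{Sp}_\omega(\Delta_s)=\bigcap_{n\in\mathbb{N}}\overline{\{\lambda_\gamma(s):\gamma\in\Pi,\ |\gamma|\ge n,\ \#\mathrm{ext}_1(\gamma)\ge2\}}$, with the metric of $\mathbb{R}$. Bi-Hölder homeomorphic: there is a homeomorphism $h$ such that $h$ and $h^{-1}$ are Hölder continuous with some positive exponents. *)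

(* Defs.v *)
From HB Require Import structures.
From mathcomp Require Import all_boot all_order all_algebra finmap.
From mathcomp Require Import all_classical all_reals all_analysis.
From mathcomp Require Import complex.

Set Implicit Arguments.
Unset Strict Implicit.
Unset Printing Implicit Defensive.

Import Order.TTheory GRing.Theory Num.Theory.
Import numFieldNormedType.Exports.

Local Open Scope classical_set_scope.
Local Open Scope ring_scope.

Section DistanceSets.
Context {R : realType}.

Definition lipschitz_map {T U : Type} (A : set T) (dA : T -> T -> R)
    (dB : U -> U -> R) (h : T -> U) : Prop :=
  exists2 C : R, 0 < C &
    forall x y, A x -> A y -> dB (h x) (h y) <= C * dA x y.

Definition hoelder_map {T U : Type} (A : set T) (dA : T -> T -> R)
    (dB : U -> U -> R) (h : T -> U) : Prop :=
  exists C alpha : R, [/\ 0 < C, 0 < alpha &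
    forall x y, A x -> A y -> dB (h x) (h y) <= C * dA x y `^ alpha].

Definition inverse_maps {T U : Type} (A : set T) (B : set U)
    (h : T -> U) (k : U -> T) : Prop :=
  [/\ set_fun A B h, set_fun B A k,
      forall x, A x -> k (h x) = x & forall y, B y -> h (k y) = y].

(* Continuity of [h] and [k] is implied by the Lipschitz, resp. Hoelder,
   estimates, so that [h] is a homeomorphism in both definitions below. *)
Definition bilipschitz_homeomorphic {T U : Type}
    (A : set T) (dA : T -> T -> R) (B : set U) (dB : U -> U -> R) : Prop :=
  exists h k, [/\ inverse_maps A B h k,
    lipschitz_map A dA dB h & lipschitz_map B dB dA k].

Definition bihoelder_homeomorphic {T U : Type}
    (A : set T) (dA : T -> T -> R) (B : set U) (dB : U -> U -> R) : Prop :=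
  exists h k, [/\ inverse_maps A B h k,
    hoelder_map A dA dB h & hoelder_map B dB dA k].

End DistanceSets.

Definition homeomorphic {T U : topologicalType} (A : set T) (B : set U) : Prop :=
  exists h k, [/\ inverse_maps A B h k,
    {within A, continuous h} & {within B, continuous k}].

(* Euclidean norm; the library's norm on ['rV[R]_d] is the sup norm. *)
Definition enorm {R : realType} {d : nat} (x : 'rV[R]_d) : R :=
  Num.sqrt (\sum_(i < d) x 0 i ^+ 2).

Definition eball {R : realType} {d : nat} (r : R) : set 'rV[R]_d :=
  [set x | enorm x <= r].

Section Tiles.
Variables (R : realType) (d m : nat).

(* The tile [(p, x)] is the translate of the prototile labelled [p] whose
   puncture is [x].  Tiles carry their label, so that prototiles with different
   labels may have the same support. *)
Definition tile : Type := ('I_m * 'rV[R]_d)%type.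

Definition translate (x : 'rV[R]_d) (P : set tile) : set tile :=
  [set (t.1, t.2 + x) | t in P].

Variable proto : 'I_m -> set 'rV[R]_d.

Definition tile_support (t : tile) : set 'rV[R]_d :=
  [set y + t.2 | y in proto t.1].

Definition covered (P : set tile) : set 'rV[R]_d :=
  \bigcup_(t in P) tile_support t.

Definition is_patch (P : set tile) : Prop :=
  forall t u, P t -> P u -> t <> u -> (tile_support t)° `&` (tile_support u)° = set0.

Definition is_tiling (P : set tile) : Prop := is_patch P /\ covered P = setT.

Definition diam_le (P : set tile) (r : R) : Prop :=
  forall x y, covered P x -> covered P y -> enorm (x - y) <= r.

End Tiles.

(* The nonempty finite set of prototiles is indexed by ['I_m.+1]. *)
Record substitution (R : realType) (d m : nat) := Substitution {
  proto : 'I_m.+1 -> set 'rV[R]_d;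
  proto_compact : forall p, compact (proto p);
  proto_ball : forall p, homeomorphic (proto p) (eball 1 : set 'rV[R]_d);
  proto_0 : forall p, (proto p)° 0;
  expansion : R;
  expansion_gt1 : 1 < expansion;
  inflate : 'I_m.+1 -> {fset 'I_m.+1 * 'rV[R]_d};
  inflate_patch : forall p, is_patch proto [set` inflate p];
  inflate_covered : forall p,
    covered proto [set` inflate p] = [set expansion *: y | y in proto p]
}.

Section Substitution.
Variables (R : realType) (d m : nat) (S : substitution R d m).

Notation tile := (tile R d m.+1).

Definition omega (P : set tile) : set tile :=
  \bigcup_(t in P) translate (expansion S *: t.2) [set` inflate S t.1].

Definition Omega : set (set tile) :=
  [set T | is_tiling (proto S) T /\
    forall F, finite_set F -> F `<=` T ->
      exists x n p, translate x F `<=` iter n omega [set (p, 0)]].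

Definition edge_count (p q : 'I_m.+1) : nat := #|` [fset t in inflate S q | t.1 == p]%fset|.

Definition adjacency : 'M[R]_m.+1 := \matrix_(p, q) (edge_count p q)%:R.

Definition primitive_substitution : Prop :=
  exists2 k, (0 < k)%N & forall p q, 0 < (adjacency ^+ k) p q.

Definition finite_local_complexity : Prop :=
  forall r : R, 0 < r -> exists2 Q : set (set tile), finite_set Q &
    forall T P, Omega T -> P `<=` T -> diam_le (proto S) P r ->
      exists P' x, Q P' /\ P = translate x P'.

Definition aperiodic_substitution : Prop :=
  forall T x, Omega T -> translate x T = T -> x = 0.

Definition canonical_transversal : set (set tile) :=
  [set T | Omega T /\ exists p, T (p, 0)].

Definition near_origin (r : R) (T : set tile) : set tile :=
  [set t | T t /\ tile_support (proto S) t `&` eball r !=set0].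

(* [sup set0 = 0] in the library, which is the required convention. *)
Definition tiling_dist (T T' : set tile) : R :=
  if `[< T = T' >] then 0 else
  (1 + sup [set r | 0 <= r /\ near_origin r T = near_origin r T'])^-1.

End Substitution.

Section Bratteli.
Variables (R : realType) (d m : nat) (S : substitution R d m).

Definition edge : Type :=
  {pq : 'I_m.+1 * 'I_m.+1 & 'I_(edge_count S pq.1 pq.2)}.

(* [inl v] is the edge from the root to [v]; [inr e] is a copy of [e] between
   two consecutive levels, the level being given by the position in the path.
   The root is the vertex [None]. *)
Definition arrow : Type := ('I_m.+1 + edge)%type.

Definition source (a : arrow) : option 'I_m.+1 :=
  match a with inl _ => None | inr e => Some (tag e).1 end.

Definition target (a : arrow) : 'I_m.+1 :=
  match a with inl v => v | inr e => (tag e).2 end.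

Definition is_path (g : seq arrow) : bool :=
  if g is a :: g' then
    (source a == None) && path (fun b c => source c == Some (target b)) a g'
  else true.

(* The end of the empty path is the root; the value [ord0] given to it here is
   never used. *)
Definition range_vertex (g : seq arrow) : 'I_m.+1 :=
  target (last (inl ord0) g).

Definition ext1 (g : seq arrow) : {set arrow} := [set a | is_path (rcons g a)].

Definition is_infinite_path (x : nat -> arrow) : Prop :=
  source (x 0%N) = None /\ forall n, source (x n.+1) = Some (target (x n)).

Record path_space := PathSpace {
  steps :> nat -> arrow;
  stepsP : is_infinite_path steps
}.

Definition prefix_of (x : path_space) (n : nat) : seq arrow := mkseq x n.

Definition cylinder (g : seq arrow) : set path_space :=
  [set x | prefix_of x (size g) = g].

Definition common_prefix (x y : path_space) : seq arrow :=
  prefix_of x (xget 0%N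
    [set n | prefix_of x n = prefix_of y n /\ x n <> y n]).

(* The measurable structure requires a point of the path space. *)
Lemma edge_into (q : 'I_m.+1) : exists e : edge, (tag e).2 = q.
Proof.
have : covered (proto S) [set` inflate S q] 0.
  rewrite inflate_covered; exists 0; last by rewrite scaler0.
  exact: interior_subset (proto_0 S q).
case=> t /= tq _.
have lt0 : (0 < edge_count S t.1 q)%N.
  by rewrite /edge_count cardfs_gt0; apply/fset0Pn; exists t; rewrite !inE /= tq eqxx.
by exists (Tagged (fun pq => 'I_(edge_count S pq.1 pq.2)) (Ordinal lt0 : 'I_(edge_count S (t.1, q).1 (t.1, q).2))).
Qed.

Lemma infinite_path_exists : exists x : nat -> arrow, is_infinite_path x.
Proof.
have [e eP] := choice edge_into.
pose pre q := (tag (e q)).1.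
have [i [k [k0 ik]]] : exists i k, (0 < k)%N /\ iter (i + k) pre ord0 = iter i pre ord0.
  have : ~ injective (fun i : 'I_m.+2 => iter i pre ord0 : 'I_m.+1).
    by move/leq_card; rewrite !card_ord ltnn.
  move=> /injectiveP/injectivePn[/= i [j ij h]].
  wlog lij : i j ij h / (i < j)%N.
    move=> H; case: (ltngtP i j) => [lij|lji|/val_inj E].
    - exact: (H i j).
    - by apply: (H j i) => //; rewrite eq_sym.
    - by rewrite E eqxx in ij.
  by exists i, (j - i)%N; rewrite subn_gt0 subnKC ?(ltnW lij).
pose v n := iter (i + (k - n %% k))%N pre ord0.
have vP n : pre (v n.+1) = v n.
  have lk := ltn_pmod n k0; rewrite /v -iterS.
  have [E|ne] := eqVneq (n %% k).+1 k.
    have -> : (n.+1 %% k = 0)%N by rewrite -addn1 -modnDml addn1 E modnn.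
    have -> : (k - n %% k = 1)%N by rewrite -[X in (X - _)%N]E subSnn.
    by rewrite subn0 iterS ik addn1.
  have lk' : ((n %% k).+1 < k)%N by rewrite ltn_neqAle ne.
  have -> : (n.+1 %% k = (n %% k).+1)%N.
    by rewrite -addn1 -modnDml addn1 modn_small.
  by rewrite -addnS -subSn // subSS.
pose x n : arrow := if n is n'.+1 then inr (e (v n'.+1)) else inl (v 0%N).
exists x; split=> // -[|n] /=; congr Some; first exact: vP.
by rewrite eP; exact: vP.
Qed.

Definition path_space_point : path_space :=
  PathSpace (projT2 (cid infinite_path_exists)).

HB.instance Definition _ := gen_eqMixin path_space.
HB.instance Definition _ := gen_choiceMixin path_space.
HB.instance Definition _ := isPointed.Build path_space path_space_point.

Definition cylinders : set (set path_space) :=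
  [set cylinder g | g in [set g | is_path g]].

End Bratteli.

(* The path space with the sigma-algebra generated by the cylinders. *)
Notation PathT S := (g_sigma_algebraType (@cylinders _ _ _ S)).

(* The spectral radius: an eigenvalue which bounds the modulus of all complex
   eigenvalues. *)
Definition perron_frobenius_eigenvalue {R : realType} {n : nat}
    (A : 'M[R]_n) (Lambda : R) : Prop :=
  eigenvalue A Lambda /\
  forall z : R[i], eigenvalue (map_mx (real_complex R) A) z ->
    `|z| <= real_complex R Lambda.

Definition perron_frobenius_eigenvector {R : realType} {n : nat}
    (A : 'M[R]_n) (Lambda : R) (nu : 'cV[R]_n) : Prop :=
  [/\ A *m nu = Lambda *: nu, forall v, 0 < nu v 0 & \sum_v nu v 0 = 1].

Section Laplacian.
Variables (R : realType) (d m : nat) (S : substitution R d m).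
Variables (Lambda : R) (nu : 'cV[R]_m.+1).

Definition weight (g : seq (arrow S)) : R :=
  if g is [::] then 1 else
  nu (range_vertex g) 0 `^ d%:R^-1 * Lambda `^ (- (size g)%:R / d%:R).

Definition path_dist (x y : path_space S) : R :=
  if `[< x = y >] then 0 else weight (common_prefix x y).

Definition is_path_measure (mu : probability (PathT S) R) : Prop :=
  forall g, is_path g -> g <> [::] ->
    mu (cylinder g) = (nu (range_vertex g) 0 * Lambda ^ (1 - (size g)%:Z))%:E.

Variable mu : probability (PathT S) R.

Definition mass (g : seq (arrow S)) : R := fine (mu (cylinder g)).

(* The diameter of the cylinder [g] is [weight g]. *)
Definition G_ (s : R) (g : seq (arrow S)) : R :=
  2^-1 * weight g `^ (2 - s) *
  \sum_(a in ext1 g) \sum_(b in ext1 g | b != a)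
    mass (rcons g a) * mass (rcons g b).

Definition lambda_ (s : R) (g : seq (arrow S)) : R :=
  \sum_(k < size g | #|ext1 (take k g)| != 1%N)
    (mass (take k g) - mass (take k.+1 g)) / G_ s (take k g)
  + mass g / G_ s g.

Definition branching (g : seq (arrow S)) : Prop :=
  is_path g /\ (2 <= #|ext1 g|)%N.

Definition E_generator (g : seq (arrow S)) (a b : arrow S) : PathT S -> R :=
  fun x => \1_(cylinder (rcons g a)) x / mass (rcons g a)
         - \1_(cylinder (rcons g b)) x / mass (rcons g b).

Definition E_ (g : seq (arrow S)) : set (PathT S -> R) :=
  [set f | exists c : arrow S -> arrow S -> R,
    f = fun x => \sum_(a in ext1 g) \sum_(b in ext1 g)
                   c a b * E_generator g a b x].

(* An operator on L^2 is represented by its action on square-integrable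
   functions, compatible with equality almost everywhere. *)
Definition acts_by (D : (PathT S -> R) -> PathT S -> R)
    (g : seq (arrow S)) (l : R) : Prop :=
  forall f, E_ g f -> D f = (fun x => l * f x) %[ae mu].

Record is_Laplacian (s : R) (D : (PathT S -> R) -> PathT S -> R) : Prop := {
  Laplacian_L2 : forall f, f \in Lfun mu 2%:E -> D f \in Lfun mu 2%:E;
  Laplacian_ae : forall f g, f \in Lfun mu 2%:E -> g \in Lfun mu 2%:E ->
    f = g %[ae mu] -> D f = D g %[ae mu];
  Laplacian_linear : forall (c : R) f g,
    f \in Lfun mu 2%:E -> g \in Lfun mu 2%:E ->
    D (fun x => c * f x + g x) = (fun x => c * D f x + D g x) %[ae mu];
  Laplacian_bounded : exists C : R, forall f, f \in Lfun mu 2%:E ->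
    ('N[mu]_2%:E[EFin \o D f] <= C%:E * 'N[mu]_2%:E[EFin \o f])%E;
  Laplacian_selfadjoint : forall f g,
    f \in Lfun mu 2%:E -> g \in Lfun mu 2%:E ->
    (\int[mu]_x (D f x * g x)%:E = \int[mu]_x (f x * D g x)%:E)%E;
  Laplacian_ge0 : forall f, f \in Lfun mu 2%:E ->
    (0 <= \int[mu]_x (D f x * f x)%:E)%E;
  Laplacian_cst : forall c : R, D (cst c) = cst 0 %[ae mu];
  Laplacian_eigen : forall g, branching g -> acts_by D g (lambda_ s g)
}.

(* Limit points of the eigenvalues of [D] on the spaces [E_ g]; each [E_ g]
   with [g] branching is nonzero, hence carries a single eigenvalue, which is
   [lambda_ s g] when [D] is the Laplacian with parameter [s]. *)
Definition Sp_omega (D : (PathT S -> R) -> PathT S -> R) : set R :=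
  \bigcap_(n : nat) closure
    [set l : R | exists2 g, (n <= size g)%N /\ branching g & acts_by D g l].

End Laplacian.

(* Main.v *)
(* Each eigenvalue is a sum, along a path, of terms of order [v ^ u] taken at the
   branching vertices, where [v = w ^ d] and [u = (s - 2) / d - 1].  At a
   branching vertex [v] shrinks by a factor at most [r < 1] which does not depend
   on [s], so that for large [s] everything after the first branching point of
   two paths is negligible.  There the two eigenvalues differ by at least a
   constant times [v ^ u], because the edges are simple and the coordinates of
   [nu] are distinct.  Letting the path grow, the limit eigenvalue [F] therefore
   satisfies [c * rho_w ^ t <= |F x - F y| <= C * rho_w ^ t] with [t = u * d], and
   since the path space is complete the omega-spectrum is exactly the range of
   [F].  That [Lambda > 1] follows from the geometry: otherwise every prototile
   would be inflated to a single tile, which is impossible for bounded sets. *)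

Require Import Defs.
From mathcomp Require Import all_boot all_order all_algebra.
From mathcomp Require Import all_classical all_reals all_analysis.
From mathcomp Require Import finmap ring lra.

Set Implicit Arguments.
Unset Strict Implicit.
Unset Printing Implicit Defensive.

Import Order.TTheory GRing.Theory Num.Theory.
Import numFieldNormedType.Exports.
Local Open Scope classical_set_scope.
Local Open Scope ring_scope.

Lemma expr_lt_eps (R : realType) (z e : R) : 0 <= z < 1 -> 0 < e -> exists n, z ^+ n < e.
Proof.
move=> /andP[z0 z1] e0.
have /cvg_expr /cvgrPdist_lt /(_ e e0) [N _ HN] : `|z| < 1 by rewrite ger0_norm.
exists N; have := HN N (leqnn N).
by rewrite /= sub0r normrN ger0_norm // exprn_ge0.
Qed.

(** * The expansion forces [Lambda > 1] *)

Section Expansion.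
Variables (R : realType) (d m : nat) (S : substitution R d m).

Lemma proto_bounded : exists B : R, forall q y, proto S q y -> `|y| <= B.
Proof.
have /choice[B BP] q : exists B : R, forall y, proto S q y -> `|y| <= B.
  have [M [_ HM]] := compact_bounded (@proto_compact _ _ _ S q).
  exists (M + 1) => y; apply: HM.
  by rewrite ltrDl.
exists (\sum_q `|B q|) => q y /BP yB.
by rewrite (bigD1 q) //= (le_trans yB) // (le_trans (ler_norm _)) // lerDl sumr_ge0.
Qed.

(* If every inflated prototile were a single tile, the difference of two points
   of a prototile would be inflated indefinitely inside a bounded set. *)
Lemma inflate_two_tiles : (1 <= d)%N ->
  exists q t u, [/\ t \in inflate S q, u \in inflate S q & t != u].
Proof.
move=> d1; apply: contrapT => single.
pose l := expansion S; have l1 : 1 < l := expansion_gt1 S.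
have l0 : 0 < l by apply: lt_trans l1.
have blow n q y y' : proto S q y -> proto S q y' -> exists q' z z',
    [/\ proto S q' z, proto S q' z' & z - z' = l ^+ n *: (y - y')].
  move=> qy qy'; elim: n => [|n [p [z [z' [pz pz' zz']]]]].
    by exists q, y, y'; rewrite expr0 scale1r.
  have cov w : proto S p w -> covered (proto S) [set` inflate S p] (l *: w).
    by move=> pw; rewrite inflate_covered; exists w.
  have [t tp [a ta al]] := cov _ pz; have [u up [b ub bl]] := cov _ pz'.
  have tu : t = u.
    by apply: contrapT => /eqP tu; apply: single; exists p, t, u.
  exists t.1, a, b; split=> //; first by rewrite tu.
  have -> : a - b = (a + t.2) - (b + u.2) by rewrite tu opprD addrACA subrr addr0.
  by rewrite al bl -scalerBr zz' scalerA -exprS.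
have [B BP] := proto_bounded.
have /nbhs_ballP[e /= e0 eP] := @proto_0 _ _ _ S ord0.
(* In the sup norm this vector stays within [e / 2] of 0, hence in the ball inside the prototile. It
   is nonzero because [d] is positive. *)
pose y : 'rV[R]_d := const_mx (e / 2).
have py : proto S ord0 y.
  apply: eP; rewrite -ball_normE /= sub0r normrN.
  apply: le_lt_trans (_ : e / 2 < e); last by lra.
  rewrite /Num.norm /= mx_normrE; apply/bigmax_leP; split; first lra.
  by move=> i _; rewrite mxE ger0_norm //; lra.
have p0 : proto S ord0 0 by apply: eP; apply: ballxx.
have y0 : 0 < `|y|.
  rewrite normr_gt0; apply/eqP => /matrixP/(_ 0 (Ordinal d1)).
  by rewrite !mxE => /eqP; rewrite mulf_eq0 invr_eq0 !gt_eqF.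
have B0 : 0 < B by apply: lt_le_trans y0 _; exact: BP py.
have [n nP] : exists n, l^-1 ^+ n < `|y| / (2 * B).
  apply: expr_lt_eps; last by rewrite divr_gt0 // mulr_gt0.
  by rewrite invr_ge0 ltW //= invf_lt1.
have [q [z [z' [qz qz' zz']]]] := blow n _ _ _ py p0.
have : `|z - z'| <= 2 * B.
  by apply: le_trans (ler_normB _ _) _; rewrite mulr_natl mulr2n lerD ?(BP q).
rewrite zz' subr0 normrZ ger0_norm ?exprn_ge0 ?(ltW l0) // leNgt => /negP; apply.
move: nP; rewrite ltr_pdivlMr ?mulr_gt0 // exprVn mulrC ltr_pdivrMr ?exprn_gt0 //.
by rewrite mulrC (mulrC `|y|).
Qed.

Lemma edge_count_gt0 q t : t \in inflate S q -> (0 < edge_count S t.1 q)%N.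
Proof.
by move=> tq; rewrite cardfs_gt0; apply/fset0Pn; exists t; rewrite !inE /= tq eqxx.
Qed.

Lemma column_sum_ge1 q : (1 <= \sum_p edge_count S p q)%N.
Proof.
have [e eq] := edge_into S q.
rewrite (bigD1 (tag e).1) //= -eq addn_gt0.
by rewrite (leq_ltn_trans (leq0n _) (ltn_ord (tagged e))).
Qed.

(** Tiles with the same label make one entry of the column at least 2; tiles with different labels
    make two entries positive. *)
Lemma column_sum_gt1 q t u : t \in inflate S q -> u \in inflate S q -> t != u ->
  (1 < \sum_p edge_count S p q)%N.
Proof.
move=> tq uq tu; have [E|ne] := eqVneq t.1 u.1.
  rewrite (bigD1 t.1) //= (leq_trans _ (leq_addr _ _)) //.
  rewrite /edge_count.
  have -> : 2%N = #|` [fset t; u]%fset| by rewrite cardfs2 tu.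
  apply: fsubset_leq_card; apply/fsubsetP => w; rewrite !inE => /orP[]/eqP->.
    by rewrite tq /=.
  by rewrite uq E /=.
rewrite (bigD1 t.1) //= (bigD1 u.1) 1?eq_sym //= addnA.
rewrite (leq_trans _ (leq_addr _ _)) // -(addn1 1).
by rewrite leq_add ?edge_count_gt0.
Qed.

Variables (Lambda : R) (nu : 'cV[R]_m.+1).
Hypothesis nuP : perron_frobenius_eigenvector (adjacency S) Lambda nu.

(** Summing the coordinates of the eigenvector equation turns [Lambda] into an average of the column
    sums, all of which are at least 1 and one of which is larger. *)
Lemma eigenvalue_column_sums :
  Lambda = \sum_q (\sum_p edge_count S p q)%:R * nu q 0.
Proof.
have [Anu _ nu1] := nuP.
transitivity (\sum_p (adjacency S *m nu) p 0).
  by rewrite Anu; under eq_bigr do rewrite mxE; rewrite -mulr_sumr nu1 mulr1.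
under eq_bigr do rewrite mxE.
rewrite exchange_big /=; apply: eq_bigr => q _.
by rewrite natr_sum mulr_suml; apply: eq_bigr => p _; rewrite mxE.
Qed.

Lemma eigenvalue_gt1 : (1 <= d)%N -> 1 < Lambda.
Proof.
move=> /inflate_two_tiles[q [t [u [tq uq tu]]]]; have [_ nu0 nu1] := nuP.
rewrite eigenvalue_column_sums -[X in X < _]nu1.
rewrite (bigD1 q) //= [ltRHS](bigD1 q) //= ltr_leD //.
  rewrite ltr_pMl // ltr1n; exact: column_sum_gt1 tu.
apply: ler_sum => p _; rewrite ler_peMl ?(ltW (nu0 p)) //.
by rewrite ler1n column_sum_ge1.
Qed.

End Expansion.
(** The default value 1 of the minimum covers an empty [P], such as the pairs of distinct vertices
    when there is one prototile. *)
Lemma finite_pos_lower_bound (R : realType) (T : finType) (P : pred T) (f : T -> R) :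
  (forall x, P x -> 0 < f x) -> exists2 e, 0 < e & forall x, P x -> e <= f x.
Proof.
move=> f0; exists (\big[Num.min/1]_(x | P x) f x).
  exact: lt_bigmin.
by move=> x Px; exact: bigmin_le_cond.
Qed.

(** * Combinatorics of paths and cylinders *)

Section Paths.
Variables (R : realType) (d m : nat) (S : substitution R d m).
Implicit Types (x y : path_space S) (g : seq (arrow S)) (a b : arrow S).

Lemma path_space_ext x y : steps x =1 steps y -> x = y.
Proof.
case: x y => [x xP] [y yP] /= /funext xy; rewrite {}xy in xP *.
by congr PathSpace; exact: Prop_irrelevance.
Qed.

Lemma prefixS x n : prefix_of x n.+1 = rcons (prefix_of x n) (x n).
Proof. exact: mkseqS. Qed.

Lemma size_prefix x n : size (prefix_of x n) = n.
Proof. exact: size_mkseq. Qed.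

Lemma take_prefix x k n : (k <= n)%N -> take k (prefix_of x n) = prefix_of x k.
Proof. by move=> kn; rewrite /prefix_of /mkseq -map_take take_iota (minn_idPl kn). Qed.

Lemma prefix_eqP x y n :
  prefix_of x n = prefix_of y n <-> forall i, (i < n)%N -> x i = y i.
Proof.
split=> [E i ilt|E]; last by apply/eq_in_map => i; rewrite mem_iota => /andP[_ /E].
by have := congr1 (fun s => nth (x 0%N) s i) E; rewrite !nth_mkseq.
Qed.

(** The least index of disagreement works. It shows that the choice in [common_prefix] is made from
    a nonempty set. *)
Lemma path_neq x y : x <> y ->
  exists n, prefix_of x n = prefix_of y n /\ x n <> y n.
Proof.
move=> xy; have ex : exists n, x n != y n.
  apply: contrapT => nex; apply: xy; apply: path_space_ext => n.
  by apply/eqP/negPn/negP => xyn; apply: nex; exists n.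
case: (ex_minnP ex) => n nxy nmin; exists n; split; last exact/eqP.
apply/prefix_eqP => i ilt; apply/eqP; apply: contraTT ilt => /nmin.
by rewrite -leqNgt.
Qed.

(** The root is [None], so that [source a] can be compared with the end of any path, including the
    empty one. *)
Definition end_vertex g : option 'I_m.+1 :=
  if g is [::] then None else Some (range_vertex g).

Lemma is_path_rcons g a :
  is_path (rcons g a) = is_path g && (source a == end_vertex g).
Proof.
case: g => [|b g] /=; first by rewrite andbT.
by rewrite rcons_path andbA.
Qed.

Lemma range_vertex_rcons g a : range_vertex (rcons g a) = target a.
Proof. by rewrite /range_vertex last_rcons. Qed.

Lemma end_vertex_prefix x n : source (x n) = end_vertex (prefix_of x n).
Proof.
case: (stepsP x) => x0 xS; case: n => [|n]; first exact: x0.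
rewrite prefixS xS -(range_vertex_rcons (prefix_of x n)).
by case: (prefix_of x n).
Qed.

Lemma prefix_is_path x n : is_path (prefix_of x n).
Proof.
elim: n => // n IHn.
by rewrite prefixS is_path_rcons IHn end_vertex_prefix eqxx.
Qed.

Lemma mem_ext1 g a : (a \in ext1 g) = is_path (rcons g a).
Proof. by rewrite inE. Qed.

Lemma step_in_ext1 x n : x n \in ext1 (prefix_of x n).
Proof. by rewrite mem_ext1 -prefixS prefix_is_path. Qed.

(** Extensions of one path share their source, so with equal targets their indices lie in the same
    ordinal type, which has at most one element. *)
Lemma ext1_target_inj g a b : (forall p q, (edge_count S p q <= 1)%N) ->
  a \in ext1 g -> b \in ext1 g -> target a = target b -> a = b.
Proof.
move=> simple; rewrite !mem_ext1 !is_path_rcons.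
move=> /andP[_ /eqP <-] /andP[_ /eqP].
case: a b => [p|[[p q] i]] [p'|[[p' q'] i']] //= => [_ ->|] //.
move=> [pp qq]; move: pp qq i' i => -> <- i' i; congr (inr (existT _ _ _)).
have := simple p q; case: i i' => [i ilt] [i' ilt'] /= le1.
apply: val_inj => /=; move: (leq_trans ilt le1) (leq_trans ilt' le1).
by case: i i' {ilt ilt'} => [|//] [].
Qed.

Lemma cylinder_nil : cylinder ([::] : seq (arrow S)) = setT.
Proof. by apply/seteqP; split. Qed.

Lemma cylinder_rcons g a :
  cylinder (rcons g a) = cylinder g `&` [set x | x (size g) = a].
Proof.
apply/seteqP; split=> x; rewrite /cylinder /= size_rcons prefixS.
  by move=> /rcons_inj[].
by move=> [-> ->].
Qed.

Lemma cylinder_ext1 g :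
  cylinder g = \bigcup_(a in [set` ext1 g]) cylinder (rcons g a).
Proof.
apply/seteqP; split=> [x gx|x [a _]]; last by rewrite cylinder_rcons => -[].
exists (x (size g)); last by rewrite cylinder_rcons.
by rewrite /= -{2}gx; exact: step_in_ext1.
Qed.

Lemma measurable_cylinder g : is_path g -> measurable (cylinder g : set (PathT S)).
Proof. by move=> pg; apply: sub_sigma_algebra; exists g. Qed.

End Paths.

(** * Masses of cylinders and constants independent of [s] *)

Section Masses.
Variables (R : realType) (d m : nat) (S : substitution R d m).
Variables (Lambda : R) (nu : 'cV[R]_m.+1) (mu : probability (PathT S) R).
Hypothesis L1 : 1 < Lambda.
Hypothesis nu_gt0 : forall p, 0 < nu p 0.
Hypothesis nu_sum : \sum_p nu p 0 = 1.
Hypothesis muP : is_path_measure Lambda nu mu.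
Implicit Types (x y : path_space S) (g : seq (arrow S)) (a b : arrow S).

Local Notation mass := (mass mu).

Let L0 : 0 < Lambda. Proof. exact: lt_trans L1. Qed.

(* The [d]-th power of the weight. *)
Definition vol g : R :=
  if g is [::] then 1 else nu (range_vertex g) 0 * Lambda ^- size g.

Lemma nu_lower_bound : exists2 e : R, 0 < e & forall p, e <= nu p 0.
Proof.
have [e e0 eP] := @finite_pos_lower_bound _ _ predT _ (fun p _ => nu_gt0 p).
by exists e => // p; exact: eP.
Qed.

Lemma nu_le1 p : nu p 0 <= 1.
Proof. by rewrite -nu_sum (bigD1 p) //= lerDl sumr_ge0 // => q _; exact: ltW. Qed.

Lemma vol_gt0 g : 0 < vol g.
Proof. by case: g => [|a g]; rewrite /vol // mulr_gt0 // invr_gt0 exprn_gt0. Qed.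

Lemma vol_le g : vol g <= Lambda ^- size g.
Proof.
case: g => [|a g]; first by rewrite /= expr0 invr1.
by rewrite /vol ler_piMl ?nu_le1 // invr_ge0 exprn_ge0 // ltW.
Qed.

Lemma vol_rcons g a : vol (rcons g a) = nu (target a) 0 * Lambda ^- (size g).+1.
Proof. by rewrite -[target a](range_vertex_rcons g) -(size_rcons g a); case: g. Qed.

Lemma mass_nil : mass [::] = 1.
Proof. by rewrite /Defs.mass cylinder_nil probability_setT. Qed.

Lemma mass_rcons g a : is_path (rcons g a) ->
  mass (rcons g a) = nu (target a) 0 * Lambda ^- size g.
Proof.
move=> pg; rewrite /Defs.mass muP //; last by case: (g).
rewrite range_vertex_rcons size_rcons /=; congr (_ * _).
by rewrite exprnN intS opprD addrA subrr add0r.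
Qed.

(** The measure carries the exponent [1 - |g|], the volume [-|g|]. At the root both are 1, so only
    the inequality [mass_le_vol] covers all paths. *)
Lemma mass_rconsE g a : is_path (rcons g a) -> mass (rcons g a) = Lambda * vol (rcons g a).
Proof.
move=> /mass_rcons->; rewrite vol_rcons mulrCA; congr (_ * _).
by rewrite exprS invfM mulVKf // gt_eqF.
Qed.

Lemma mass_gt0 g : is_path g -> 0 < mass g.
Proof.
case/lastP: g => [|g a]; first by rewrite mass_nil.
by move=> /mass_rconsE->; rewrite mulr_gt0 ?vol_gt0.
Qed.

Lemma mass_le_vol g : is_path g -> mass g <= Lambda * vol g.
Proof.
case/lastP: g => [|g a]; first by rewrite mass_nil mulr1 ltW.
by move=> /mass_rconsE->.
Qed.

(** Positive mass excludes the empty set; finite paths are extended to infinite ones in this way. *)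
Lemma cylinder_nonempty g : is_path g -> cylinder g !=set0.
Proof.
move=> pg; apply/set0P/eqP => g0.
by have := mass_gt0 pg; rewrite /Defs.mass g0 measure0 ltxx.
Qed.

Lemma mass_ext1 g : is_path g -> \sum_(a in ext1 g) mass (rcons g a) = mass g.
Proof.
move=> pg; rewrite /Defs.mass [in RHS]cylinder_ext1.
have -> : [set` ext1 g] = [set` enum (ext1 g)].
  by apply/seteqP; split=> a /=; rewrite mem_enum.
rewrite measure_fin_bigcup //=.
- rewrite -fsbig_seq ?enum_uniq // big_enum /= sum_fine // => a.
  rewrite mem_ext1 => pga; apply: fin_num_measure; exact: measurable_cylinder.
- by move=> a b _ _ [x []]; rewrite !cylinder_rcons => -[_ <-] [_ <-].
- by move=> a; rewrite /= mem_enum mem_ext1 => pga; exact: measurable_cylinder.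
Qed.


Definition pair_sum g : R :=
  \sum_(a in ext1 g) \sum_(b in ext1 g | b != a) mass (rcons g a) * mass (rcons g b).

(* The inverse of [G_ s g] is [coef g * vol g `^ u] for [s = d * (u + 1) + 2]:
   the factor [coef g] does not depend on [s]. *)
Definition coef g : R := 2 * vol g / pair_sum g.

Lemma mass_rcons_ge0 g a : a \in ext1 g -> 0 <= mass (rcons g a).
Proof. by rewrite mem_ext1 => /mass_gt0/ltW. Qed.

Lemma pair_sum_ge g a b : a \in ext1 g -> b \in ext1 g -> a != b ->
  mass (rcons g a) * mass (rcons g b) <= pair_sum g.
Proof.
move=> ga gb ab; rewrite /pair_sum (bigD1 a) //= (bigD1 b) ?gb 1?eq_sym //=.
rewrite -addrA lerDl addr_ge0 //; last apply: sumr_ge0 => a' /andP[ga' _].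
  by apply: sumr_ge0 => b' /andP[/andP[gb' _] _]; rewrite mulr_ge0 ?mass_rcons_ge0.
by apply: sumr_ge0 => b' /andP[gb' _]; rewrite mulr_ge0 ?mass_rcons_ge0.
Qed.

(** Adding the diagonal terms completes the double sum to a square. *)
Lemma pair_sum_le g : is_path g -> pair_sum g <= mass g ^+ 2.
Proof.
move=> pg; rewrite expr2 -{1}(mass_ext1 pg) mulr_suml; apply: ler_sum => a ga.
rewrite -mulr_sumr ler_wpM2l ?mass_rcons_ge0 // -(mass_ext1 pg).
rewrite [leRHS](bigID (fun b => b != a)) /= lerDl sumr_ge0 // => b /andP[gb _].
exact: mass_rcons_ge0.
Qed.

Lemma branching_pair g : branching g ->
  exists a b, [/\ a \in ext1 g, b \in ext1 g & a != b].
Proof. by move=> [_ /card_gt1P[a [b [ga gb ab]]]]; exists a, b. Qed.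

Lemma pair_branching g a b : a \in ext1 g -> b \in ext1 g -> a != b -> branching g.
Proof.
move=> ga gb ab; split; last by apply/card_gt1P; exists a, b.
by move: ga; rewrite mem_ext1 is_path_rcons => /andP[].
Qed.

Lemma pair_sum_gt0 g : branching g -> 0 < pair_sum g.
Proof.
move=> /branching_pair[a [b [ga gb ab]]]; apply: lt_le_trans (pair_sum_ge ga gb ab).
by rewrite mulr_gt0 // mass_gt0 -?mem_ext1.
Qed.

Lemma coef_gt0 g : branching g -> 0 < coef g.
Proof. by move=> bg; rewrite divr_gt0 ?pair_sum_gt0 // mulr_gt0 // vol_gt0. Qed.

Lemma mass_rcons_ge g a e : (forall p, e <= nu p 0) -> 0 <= e -> a \in ext1 g ->
  e * vol g <= mass (rcons g a).
Proof.
move=> enu e0; rewrite mem_ext1 => /mass_rcons->.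
by rewrite ler_pM ?vol_le // ltW // vol_gt0.
Qed.

(** Each extension has mass at least [e * vol g], so [pair_sum g] is at least its square, while the
    mass is at most [Lambda * vol g]: the powers of [vol g] cancel. *)
Lemma coef_mass_le : exists2 K : R, 0 < K &
  forall g, branching g -> coef g * mass g <= K.
Proof.
have [e e0 eP] := nu_lower_bound.
exists (2 * Lambda / e ^+ 2); first by rewrite divr_gt0 ?exprn_gt0 // mulr_gt0.
move=> g bg; have pg := bg.1; rewrite /coef mulrAC ler_pdivrMr ?pair_sum_gt0 //.
have [a [b [ga gb ab]]] := branching_pair bg.
have ev := @mass_rcons_ge g _ e eP (ltW e0).
have ev0 : 0 <= e * vol g by rewrite mulr_ge0 // ltW // vol_gt0.
have P : (e * vol g) ^+ 2 <= pair_sum g.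
  by apply: le_trans (pair_sum_ge ga gb ab); rewrite expr2 ler_pM ?ev.
rewrite [leRHS]mulrAC ler_pdivlMr ?exprn_gt0 //.
have := mass_le_vol pg; have := vol_gt0 g; have L0' := L0; move: P; clear - e0 L0'.
move: (pair_sum g) (vol g) (mass g) => P v M Pv v0 Mv.
apply: le_trans (_ : 2 * v * (Lambda * v) * e ^+ 2 <= _).
  by rewrite ler_pM2r ?exprn_gt0 // ler_pM2l // mulr_gt0.
have -> : 2 * v * (Lambda * v) * e ^+ 2 = 2 * Lambda * (e * v) ^+ 2 by ring.
by rewrite ler_pM2l // mulr_gt0.
Qed.

(** Distinct simple edges have distinct targets, hence distinct coordinates of [nu], and the masses
    differ by at least [e * vol g]. Since [pair_sum g] is at most [(Lambda * vol g) ^+ 2], the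
    volumes cancel again. *)
Lemma coef_mass_diff_ge : (forall p q, (edge_count S p q <= 1)%N) ->
  (forall p q, p != q -> nu p 0 != nu q 0) ->
  exists2 c : R, 0 < c & forall g a b, a \in ext1 g -> b \in ext1 g -> a != b ->
    c <= coef g * `|mass (rcons g a) - mass (rcons g b)|.
Proof.
move=> simple nu_inj.
have [e e0 eP] : exists2 e, 0 < e & forall p q, p != q -> e <= `|nu p 0 - nu q 0|.
  have [|e e0 eP] := @finite_pos_lower_bound R _
    (fun pq : 'I_m.+1 * 'I_m.+1 => pq.1 != pq.2) (fun pq => `|nu pq.1 0 - nu pq.2 0|).
    by move=> [p q] /= /nu_inj; rewrite normr_gt0 subr_eq0.
  by exists e => // p q pq; exact: (eP (p, q)).
exists (2 * e / Lambda ^+ 2); first by rewrite divr_gt0 ?exprn_gt0 // mulr_gt0.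
move=> g a b ga gb ab; have bg := pair_branching ga gb ab; have pg := bg.1.
have tab : target a != target b.
  by apply: contra_neq ab => tab; exact: (ext1_target_inj simple ga gb tab).
rewrite !mass_rcons -?mem_ext1 // -mulrBl normrM.
have nL : 0 <= Lambda ^- size g by rewrite invr_ge0 exprn_ge0 // ltW.
rewrite (ger0_norm nL) /coef [leRHS]mulrAC ler_pdivlMr ?pair_sum_gt0 //.
have V : e * vol g <= `|nu (target a) 0 - nu (target b) 0| / Lambda ^+ size g.
  by rewrite ler_pM ?vol_le ?eP // ltW // vol_gt0.
have P : pair_sum g <= (Lambda * vol g) ^+ 2.
  apply: le_trans (pair_sum_le pg) _.
  by rewrite lerXn2r ?nnegrE ?mass_le_vol // ltW ?mass_gt0 // mulr_gt0 ?vol_gt0.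
apply: le_trans (_ : 2 * e / Lambda ^+ 2 * (Lambda * vol g) ^+ 2 <= _).
  by rewrite ler_pM2l // divr_gt0 ?exprn_gt0 // mulr_gt0.
have -> : 2 * e / Lambda ^+ 2 * (Lambda * vol g) ^+ 2 = 2 * vol g * (e * vol g).
  by field; rewrite gt_eqF.
by rewrite ler_pM2l // mulr_gt0 ?vol_gt0.
Qed.

(** A sibling of [a] takes mass at least [e * vol g] out of at most [Lambda * vol g], which gives
    [r = 1 - e / Lambda]. *)
Lemma vol_branching_contract : exists2 r : R, 0 < r < 1 &
  forall g a, branching g -> a \in ext1 g -> vol (rcons g a) <= r * vol g.
Proof.
have [e e0 eP] := nu_lower_bound.
have e1 : e < Lambda by apply: le_lt_trans L1; apply: le_trans (nu_le1 ord0).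
exists (1 - e / Lambda).
  by rewrite subr_gt0 ltr_pdivrMr // mul1r e1 /= gtrBl divr_gt0.
move=> g a bg ga; have pg := bg.1.
have [b [gb ab]] : exists b, b \in ext1 g /\ b != a.
  have [b [b' [gb gb' bb']]] := branching_pair bg.
  have [ba|ne] := eqVneq b a; last by exists b.
  by exists b'; rewrite -ba eq_sym.
have : mass (rcons g a) + mass (rcons g b) <= mass g.
  rewrite -(mass_ext1 pg) (bigD1 a) //= lerD2l (bigD1 b) /= ?gb // lerDl.
  by apply: sumr_ge0 => c /andP[/andP[gc _] _]; exact: mass_rcons_ge0.
have := mass_rcons_ge eP (ltW e0) gb; have := mass_le_vol pg.
rewrite [mass (rcons g a)]mass_rconsE -?mem_ext1 // => h1 h2 h3.
rewrite -(ler_pM2l L0).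
have -> : Lambda * ((1 - e / Lambda) * vol g) = Lambda * vol g - e * vol g.
  by field; rewrite gt_eqF.
lra.
Qed.

Lemma vol_rcons_le g a : a \in ext1 g -> vol (rcons g a) <= vol g.
Proof.
move=> ga; have pga : is_path (rcons g a) by rewrite -mem_ext1.
have pg : is_path g by move: pga; rewrite is_path_rcons => /andP[].
rewrite -(ler_pM2l L0) -mass_rconsE //; apply: le_trans (mass_le_vol pg).
rewrite -(mass_ext1 pg) (bigD1 a) //= lerDl sumr_ge0 // => b /andP[gb _].
exact: mass_rcons_ge0.
Qed.

Lemma weightE g : (0 < d)%N -> weight Lambda nu g = vol g `^ d%:R^-1.
Proof.
move=> d0; case: g => [|a g]; first by rewrite /= powR1.
rewrite /weight /vol powRM ?ltW ?invr_gt0 ?exprn_gt0 //; congr (_ * _).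
by rewrite powRrM powRN powR_mulrn // ltW.
Qed.

(** The exponent [(2 - s) / d] of the volume becomes [- (u + 1)]; the extra factor [vol g] is
    absorbed in [coef]. *)
Lemma inv_GE u g : (0 < d)%N ->
  (G_ Lambda nu mu (d%:R * (u + 1) + 2) g)^-1 = coef g * vol g `^ u.
Proof.
move=> d0; have v0 := vol_gt0 g.
rewrite /G_ -/(pair_sum g) weightE // -powRrM.
have -> : d%:R^-1 * (2 - (d%:R * (u + 1) + 2)) = - (u + 1) :> R.
  by field; rewrite pnatr_eq0 -lt0n.
have -> : vol g `^ (- (u + 1)) = (vol g `^ u * vol g)^-1.
  rewrite powRN powRD; first by rewrite powRr1 // ltW.
  by rewrite (gt_eqF v0) implybT.
rewrite /coef !invfM !invrK.
by ring.
Qed.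


(** A generator of [E_ mu g] is a nonzero constant on the cylinder of [rcons g a]. Two different
    scalars would make that cylinder null, but its mass is positive. *)
Lemma acts_by_unique (D : (PathT S -> R) -> PathT S -> R) g l l' : branching g ->
  acts_by mu D g l -> acts_by mu D g l' -> l = l'.
Proof.
move=> /branching_pair[a [b [ga gb ab]]] gl gl'.
have pga : is_path (rcons g a) by rewrite -mem_ext1.
pose f := E_generator mu g a b.
have Ef : E_ mu g f.
  exists (fun a' b' => ((a' == a) && (b' == b))%:R); apply/funext => x.
  rewrite (bigD1 a) //= (bigD1 b) //= !eqxx mul1r.
  rewrite big1 ?addr0 => [|b' /andP[_ /negPf->]]; last by rewrite andbF mul0r.
  rewrite big1 ?addr0 // => a' /andP[_ /negPf->].
  by rewrite big1 // => b' _; rewrite mul0r.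
apply: contrapT => ll'.
have [N [mN N0 NP]] : \forall x \ae mu, l * f x = l' * f x.
  by apply: filterS2 (gl f Ef) (gl' f Ef) => x h1 h2; rewrite -h1 // -h2.
have : (mu (cylinder (rcons g a)) <= mu N)%E.
  have mc := measurable_cylinder pga.
  apply: le_measure; [exact/mem_set|exact/mem_set|].
  move=> x gax; apply: NP => /= E; apply: ll'.
  apply: (mulIf _ E); rewrite /f /E_generator.
  rewrite indicE mem_set // mul1r indicE memNset ?mul0r ?subr0.
    by rewrite invr_eq0 gt_eqF // mass_gt0.
  by move: gax; rewrite !cylinder_rcons => -[_ /= ->] [_ /eqP]; apply/negP.
rewrite N0 => m0; have := mass_gt0 pga; rewrite /Defs.mass.
have -> : mu (cylinder (rcons g a)) = 0%E by apply/eqP; rewrite eq_le m0 measure_ge0.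
by rewrite ltxx.
Qed.

(** * Eigenvalues along an infinite path as partial sums *)

Definition step_term u x n : R :=
  coef (prefix_of x n) * vol (prefix_of x n) `^ u *
  (mass (prefix_of x n) - mass (prefix_of x n.+1)).

Definition partial_eigenvalue u x n : R := \sum_(k < n) step_term u x k.

Definition limit_eigenvalue u x : R := limn (partial_eigenvalue u x).

Lemma mass_nonbranching x n : #|ext1 (prefix_of x n)| = 1%N ->
  mass (prefix_of x n.+1) = mass (prefix_of x n).
Proof.
move=> /eqP/cards1P[a aP]; have := step_in_ext1 x n.
rewrite aP inE => /eqP xa; rewrite prefixS xa -(mass_ext1 (prefix_is_path x n)).
by rewrite aP big_set1.
Qed.

Lemma branching_prefix x n : #|ext1 (prefix_of x n)| = 1%N \/ branching (prefix_of x n).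
Proof.
have : (0 < #|ext1 (prefix_of x n)|)%N by apply/card_gt0P; exists (x n); exact: step_in_ext1.
rewrite leq_eqVlt => /orP[/eqP<-|h]; [by left|right].
by split=> //; exact: prefix_is_path.
Qed.

(** Where there is one extension the mass does not drop and the step term vanishes, so the filter in
    [lambda_] can be omitted. *)
Lemma lambda_prefix u x n : (0 < d)%N ->
  lambda_ Lambda nu mu (d%:R * (u + 1) + 2) (prefix_of x n) =
  partial_eigenvalue u x n +
    coef (prefix_of x n) * vol (prefix_of x n) `^ u * mass (prefix_of x n).
Proof.
move=> d0; rewrite /lambda_ size_prefix inv_GE // [mass _ * _]mulrC; congr (_ + _).
rewrite [RHS](bigID (fun k : 'I_n => #|ext1 (prefix_of x k)| != 1%N)) /=.
rewrite [X in _ = _ + X]big1 ?addr0; last first.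
  by move=> k /negPn/eqP k1; rewrite /step_term mass_nonbranching // subrr mulr0.
apply: eq_big => [k|k _]; first by rewrite take_prefix // ltnW.
by rewrite !take_prefix ?(ltnW (ltn_ord k)) // inv_GE // mulrC.
Qed.

Lemma partial_eigenvalue_prefix u x y n : prefix_of x n = prefix_of y n ->
  partial_eigenvalue u x n = partial_eigenvalue u y n.
Proof.
move=> xy; apply: eq_bigr => k _; rewrite /step_term.
rewrite -(@take_prefix _ _ _ _ x k n) ?(ltnW (ltn_ord k)) //.
by rewrite -(@take_prefix _ _ _ _ x k.+1 n) // xy !take_prefix // ltnW.
Qed.

(** * Convergence and upper estimates *)

Section Eigenvalues.
(** [K], [r] and [c] are the constants from [coef_mass_le], [vol_branching_contract] and
    [coef_mass_diff_ge]; they do not involve [u], which can be chosen after them. *)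
Variables (u K r c : R).
Hypothesis u0 : 0 < u.
Hypothesis coefK : forall g, branching g -> coef g * mass g <= K.
Hypothesis K0 : 0 < K.
Hypothesis r01 : 0 < r < 1.
Hypothesis contract : forall g a, branching g -> a \in ext1 g ->
  vol (rcons g a) <= r * vol g.

Local Notation V x n := (vol (prefix_of x n) `^ u).
(** The sum of a geometric series with first term [K] and ratio [r ^ u], one term for each
    branching. *)
Local Notation K' := (K / (1 - r `^ u)).

Lemma powR_ratio_lt1 : r `^ u < 1.
Proof.
have /andP[r0 r1] := r01; have <- : 1 `^ u = 1 :> R by rewrite powR1.
apply: gt0_ltr_powR => //.
- by rewrite nnegrE ltW.
- by rewrite nnegrE.
Qed.

Lemma tail_bound_gt0 : 0 < K'.
Proof. by rewrite divr_gt0 // subr_gt0 powR_ratio_lt1. Qed.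

Lemma V_branching x n : branching (prefix_of x n) -> V x n.+1 <= r `^ u * V x n.
Proof.
move=> bx; have /andP[r0 r1] := r01.
have v0 g : 0 <= vol g by exact/ltW/vol_gt0.
rewrite -powRM ?(ltW r0) //; apply: ge0_ler_powR; rewrite ?nnegrE ?(ltW u0) //.
  by rewrite mulr_ge0 // ltW.
by rewrite prefixS; exact: contract (step_in_ext1 x n).
Qed.

Lemma V_nonincreasing x n : V x n.+1 <= V x n.
Proof.
apply: ge0_ler_powR; rewrite ?nnegrE ?(ltW (vol_gt0 _)) ?(ltW u0) //.
by rewrite prefixS; exact: vol_rcons_le (step_in_ext1 x n).
Qed.

Lemma V_antitone x n k : (n <= k)%N -> V x k <= V x n.
Proof.
elim: k => [|k IHk]; first by rewrite leqn0 => /eqP->.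
rewrite leq_eqVlt => /orP[/eqP->//|]; rewrite ltnS => /IHk.
by apply: le_trans; exact: V_nonincreasing.
Qed.

Lemma V_le x n : V x n <= (Lambda^-1 `^ u) ^+ n.
Proof.
rewrite -powR_mulrn ?powR_ge0 // powRAC powR_mulrn ?invr_ge0 ?(ltW L0) // exprVn.
have := vol_le (prefix_of x n); rewrite size_prefix => vle.
apply: ge0_ler_powR; rewrite ?nnegrE ?(ltW (vol_gt0 _)) ?(ltW u0) //.
by rewrite invr_ge0 exprn_ge0 // ltW.
Qed.

Lemma exists_V_lt e : 0 < e -> exists n, forall x k, (n <= k)%N -> V x k < e.
Proof.
move=> e0; have [n nP] : exists n, (Lambda^-1 `^ u) ^+ n < e.
  apply: expr_lt_eps => //; rewrite powR_ge0 /=; have <- : 1 `^ u = 1 :> R by rewrite powR1.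
  apply: gt0_ltr_powR => //; rewrite ?nnegrE ?invr_ge0 ?(ltW L0) //.
  by rewrite invf_lt1.
exists n => x k nk; apply: le_lt_trans nP; apply: le_trans (V_le x n).
exact: V_antitone.
Qed.

(* At a branching vertex [V] drops by a definite factor, at the other vertices
   the term vanishes; this is what makes the series telescope. *)
Lemma step_term_bounds x n : 0 <= step_term u x n <= K' * (V x n - V x n.+1).
Proof.
have V0 : 0 <= V x n by exact: powR_ge0.
have [x1|bx] := branching_prefix x n.
  rewrite /step_term mass_nonbranching // subrr mulr0 lexx /=.
  by rewrite mulr_ge0 ?(ltW tail_bound_gt0) // subr_ge0 V_nonincreasing.
have cf := ltW (coef_gt0 bx); have m0 := ltW (mass_gt0 (prefix_is_path x n.+1)).
have m1 : mass (prefix_of x n.+1) <= mass (prefix_of x n).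
  rewrite -(mass_ext1 (prefix_is_path x n)) prefixS (bigD1 (x n)) ?step_in_ext1 //=.
  by rewrite lerDl sumr_ge0 // => b /andP[gb _]; exact: mass_rcons_ge0.
apply/andP; split; first by rewrite mulr_ge0 ?subr_ge0 // mulr_ge0.
apply: le_trans (_ : K * V x n <= _).
  rewrite /step_term mulrAC ler_wpM2r //; apply: le_trans (coefK bx).
  by rewrite ler_wpM2l // lerBlDr lerDl.
have R1 : 0 < 1 - r `^ u by rewrite subr_gt0 powR_ratio_lt1.
rewrite mulrAC ler_pdivlMr // -mulrA ler_pM2l //.
by rewrite mulrC mulrBl mul1r lerD2l lerN2 V_branching.
Qed.

Lemma partial_eigenvalueS x n :
  partial_eigenvalue u x n.+1 = partial_eigenvalue u x n + step_term u x n.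
Proof. by rewrite /partial_eigenvalue big_ord_recr. Qed.

Lemma partial_eigenvalue_tail x n k :
  partial_eigenvalue u x n <= partial_eigenvalue u x (n + k) <=
  partial_eigenvalue u x n + K' * (V x n - V x (n + k)).
Proof.
elim: k => [|k /andP[IH1 IH2]]; first by rewrite addn0 subrr mulr0 addr0 lexx.
rewrite addnS partial_eigenvalueS.
have /andP[h1 h2] := step_term_bounds x (n + k).
rewrite (le_trans IH1) ?lerDl //=.
apply: le_trans (lerD IH2 h2) _.
by rewrite -addrA -mulrDr subrKA.
Qed.

(** The partial sums increase, and the telescoped tail keeps them below the upper bound, which
    passes to the limit. *)
Lemma limit_eigenvalue_bounds x n :
  partial_eigenvalue u x n <= limit_eigenvalue u x <=
  partial_eigenvalue u x n + K' * V x n.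
Proof.
have nd : nondecreasing_seq (partial_eigenvalue u x).
  move=> i j ij; rewrite -(subnKC ij).
  by have /andP[] := partial_eigenvalue_tail x i (j - i).
have ub N k : partial_eigenvalue u x (N + k) <= partial_eigenvalue u x N + K' * V x N.
  have /andP[_ h] := partial_eigenvalue_tail x N k; apply: le_trans h _.
  by rewrite lerD2l ler_pM2l ?tail_bound_gt0 // lerBlDr lerDl powR_ge0.
have cv : cvgn (partial_eigenvalue u x).
  apply: nondecreasing_is_cvgn => //.
  exists (partial_eigenvalue u x 0 + K' * V x 0) => _ [k _ <-].
  by rewrite -[k]add0n ub.
rewrite /limit_eigenvalue nondecreasing_cvgn_le //=.
apply: limr_le => //; exists n => // k /= nk.
by rewrite -(subnKC nk) ub.
Qed.

Lemma limit_eigenvalue_upper x y n : prefix_of x n = prefix_of y n ->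
  `|limit_eigenvalue u x - limit_eigenvalue u y| <= K' * V x n.
Proof.
move=> xy; have /andP[x1 x2] := limit_eigenvalue_bounds x n.
have /andP[] := limit_eigenvalue_bounds y n.
rewrite -(partial_eigenvalue_prefix u xy) -xy => y1 y2.
by rewrite ler_norml; apply/andP; split; lra.
Qed.

(** The last term of [lambda_] is at most [K * V x n], and [K <= K'], so both numbers lie in the
    interval of [limit_eigenvalue_bounds]. *)
Lemma limit_eigenvalue_lambda x n : (0 < d)%N -> branching (prefix_of x n) ->
  `|limit_eigenvalue u x -
    lambda_ Lambda nu mu (d%:R * (u + 1) + 2) (prefix_of x n)| <= K' * V x n.
Proof.
move=> d0 bx; have /andP[x1 x2] := limit_eigenvalue_bounds x n.
rewrite lambda_prefix //; move: (coef_gt0 bx) (mass_gt0 bx.1) (coefK bx).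
move: (coef _) (mass _) => cf M cf0 M0 cfK.
have V0 : 0 <= V x n by exact: powR_ge0.
have KK : K <= K'.
  rewrite ler_pdivlMr ?subr_gt0 ?powR_ratio_lt1 // ler_piMr ?(ltW K0) //.
  by rewrite lerBlDr lerDl powR_ge0.
have h0 : 0 <= cf * V x n * M by rewrite !mulr_ge0 // ltW.
have h1 : cf * V x n * M <= K' * V x n.
  by rewrite mulrAC ler_wpM2r // (le_trans cfK).
by rewrite ler_norml; apply/andP; split; lra.
Qed.

(** * Lower estimates and separation of paths *)

Hypothesis c0 : 0 < c.
Hypothesis coef_diff : forall g a b, a \in ext1 g -> b \in ext1 g -> a != b ->
  c <= coef g * `|mass (rcons g a) - mass (rcons g b)|.
Hypothesis uc : K' * r `^ u <= c / 2.

(* The first step at which two paths differ moves the eigenvalue by at least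
   [c * V]; all the later steps together by at most half as much. *)
Lemma limit_eigenvalue_lower x y n : prefix_of x n = prefix_of y n -> x n <> y n ->
  c / 2 * V x n <= `|limit_eigenvalue u x - limit_eigenvalue u y|.
Proof.
move=> xy /eqP nxy.
have gx := step_in_ext1 x n; have gy := step_in_ext1 y n; rewrite -xy in gy.
have bx := pair_branching gx gy nxy.
have V0 : 0 <= V x n by exact: powR_ge0.
have tail z : prefix_of z n = prefix_of x n -> K' * V z n.+1 <= c / 2 * V x n.
  move=> zx; apply: le_trans (_ : K' * (r `^ u * V x n) <= _).
    by rewrite ler_pM2l ?tail_bound_gt0 // -zx V_branching // zx.
  by rewrite mulrA ler_wpM2r.
have /andP[x1 x2] := limit_eigenvalue_bounds x n.+1.
have /andP[y1 y2] := limit_eigenvalue_bounds y n.+1.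
have tx := tail x erefl; have ty := tail y (esym xy).
(* The first [n] terms agree, and step [n] has the same factor for both paths, so only the masses of
   the two extensions are compared. *)
have diff : c * V x n <=
    `|partial_eigenvalue u x n.+1 - partial_eigenvalue u y n.+1|.
  rewrite !partial_eigenvalueS (partial_eigenvalue_prefix u xy).
  rewrite opprD addrACA subrr add0r /step_term -xy -mulrBr opprB [X in _ * _ * X]addrC subrKA.
  rewrite !prefixS -xy normrM normrM (ger0_norm V0) (gtr0_norm (coef_gt0 bx)).
  by rewrite mulrAC ler_wpM2r // distrC coef_diff.
move: diff x1 x2 y1 y2 tx ty.
set a := partial_eigenvalue _ _ _; set b := partial_eigenvalue _ _ _.
set F1 := limit_eigenvalue _ _; set F2 := limit_eigenvalue _ _.
set p := K' * _; set q := K' * _; set w := _ `^ u.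
move=> diff x1 x2 y1 y2 tx ty.
(* Tails are nonnegative, so only one of the two works against the difference and half of [c * V]
   survives. *)
have [ab|ab] := lerP 0 (a - b); move: diff.
  rewrite (ger0_norm ab) => diff; apply: le_trans (ler_norm _); lra.
rewrite (ltr0_norm ab) => diff; rewrite distrC; apply: le_trans (ler_norm _); lra.
Qed.

Lemma limit_eigenvalue_inj : injective (limit_eigenvalue u).
Proof.
move=> x y Fxy; apply: contrapT => /path_neq[n [xy nxy]].
have := limit_eigenvalue_lower xy nxy; rewrite Fxy subrr normr0 leNgt => /negP; apply.
by rewrite mulr_gt0 ?powR_gt0 ?vol_gt0 // divr_gt0.
Qed.

(** The weight is [vol ^ (1 / d)], so the power [u * d] of the distance is [V] at the first
    disagreement. *)
Lemma path_dist_bounds x y : (0 < d)%N ->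
  c / 2 * path_dist Lambda nu x y `^ (u * d%:R) <=
    `|limit_eigenvalue u x - limit_eigenvalue u y| <=
  K' * path_dist Lambda nu x y `^ (u * d%:R).
Proof.
move=> d0; have d0' : 0 < d%:R :> R by rewrite ltr0n.
rewrite /path_dist; case: asboolP => [->|xy].
  by rewrite subrr normr0 powR0 ?mulr0 ?lexx // gt_eqF // mulr_gt0.
have /(xgetPex 0%N) [pxy nxy] := path_neq xy.
rewrite weightE // -/(common_prefix x y) -powRrM.
have -> : d%:R^-1 * (u * d%:R) = u by field; rewrite gt_eqF.
by rewrite limit_eigenvalue_lower // limit_eigenvalue_upper.
Qed.

(** Paths with different prefixes part at a level [n <= k], where [V] is at least its value at level
    [k]; that value is bounded below uniformly. *)
Lemma limit_eigenvalue_separated k : exists2 e, 0 < e & forall x y,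
  `|limit_eigenvalue u x - limit_eigenvalue u y| < e -> prefix_of x k = prefix_of y k.
Proof.
have [e e0 eP] := nu_lower_bound.
(* The 1 accounts for the root, whose volume is 1. *)
pose e' := Num.min e 1.
have e'0 : 0 < e' by rewrite lt_min e0 ltr01.
have vk x : e' * Lambda ^- k <= vol (prefix_of x k).
  have := size_prefix x k; rewrite /vol; case: (prefix_of x k) => [<-|a g sg].
    by rewrite expr0 invr1 mulr1 ge_min lexx orbT.
  by rewrite -sg ler_pM2r ?invr_gt0 ?exprn_gt0 // ge_min eP.
have V0 : 0 < e' * Lambda ^- k by rewrite divr_gt0 ?exprn_gt0.
exists (c / 2 * (e' * Lambda ^- k) `^ u).
  by rewrite mulr_gt0 ?powR_gt0 // divr_gt0.
move=> x y; apply: contraPP => pxy.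
have /path_neq[n [xyn nxy]] : x <> y by move=> xy; apply: pxy; rewrite xy.
have nk : (n <= k)%N.
  rewrite leqNgt; apply/negP => kn; apply: pxy.
  by rewrite -(take_prefix x (ltnW kn)) xyn take_prefix // ltnW.
apply/negP; rewrite -leNgt; apply: le_trans (limit_eigenvalue_lower xyn nxy).
rewrite ler_pM2l ?divr_gt0 //; apply: le_trans (_ : V x k <= _).
  by apply: ge0_ler_powR; rewrite ?nnegrE ?(ltW V0) ?(ltW (vol_gt0 _)) ?(ltW u0).
exact: V_antitone.
Qed.

(* Completeness of the path space, transported along the separation estimate. *)
Lemma limit_eigenvalue_closed_range l :
  (forall e, 0 < e -> exists x, `|l - limit_eigenvalue u x| < e) ->
  range (limit_eigenvalue u) l.
Proof.
move=> approx.
have /choice[e eP] k : exists e, 0 < e /\ forall x y,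
    `|limit_eigenvalue u x - limit_eigenvalue u y| < e -> prefix_of x k = prefix_of y k.
  by have [e e0 eP] := limit_eigenvalue_separated k; exists e.
have /choice[y yP] k : exists y, `|l - limit_eigenvalue u y| < e k / 2.
  by apply: approx; rewrite divr_gt0 //; case: (eP k).
(* A diagonal path: [y n.+1] is close enough to settle the first [n.+1] steps, the last of which has
   index [n]. *)
pose x n := steps (y n.+1) n.
(* If the value of [z] is within every [e k / 2], [k <= N], of [l], then [z] agrees with each such
   [y k] on [k] steps. That [x] is a path, and that its value is [l], are both read off such [z]. *)
have near_x N t : 0 < t -> exists z, `|l - limit_eigenvalue u z| < t /\
    forall n, (n < N)%N -> x n = z n.
  move=> t0.
  have [t' t'0 t'P] := @finite_pos_lower_bound _ 'I_N.+1 predT (fun k => e k / 2)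
    (fun k _ => divr_gt0 (eP k).1 (ltr0Sn R 1)).
  have [|z] := approx (Num.min t t'); first by rewrite lt_min t0.
  rewrite lt_min => /andP[zt zt']; exists z; split=> // n nN.
  have : prefix_of (y n.+1) n.+1 = prefix_of z n.+1.
    apply: (eP n.+1).2.
    have := t'P (Ordinal (nN : (n.+1 < N.+1)%N)) isT; have := yP n.+1; rewrite /= => h1 h2.
    by rewrite -(subrKA l); apply: le_lt_trans (ler_normD _ _) _; rewrite (distrC _ l); lra.
  by move=> /prefix_eqP; apply.
have xP : is_infinite_path x.
  split=> [|n].
    by have [z [_ ->//]] := near_x 1%N 1 ltr01; case: (stepsP z).
  have [z [_ xz]] := near_x n.+2 1 ltr01.
  by rewrite !xz //; case: (stepsP z).
exists (PathSpace xP) => //; apply/eqP; rewrite eq_sym -subr_eq0 -normr_le0.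
apply/ler_addgt0Pr => t t0; rewrite add0r.
have [N NP] := @exists_V_lt (t / 2 / K') (divr_gt0 (divr_gt0 t0 (ltr0Sn R 1)) tail_bound_gt0).
have [z [zt xz]] := near_x N (t / 2) (divr_gt0 t0 (ltr0Sn R 1)).
have pxz : prefix_of (PathSpace xP) N = prefix_of z N by apply/prefix_eqP.
have := limit_eigenvalue_upper pxz.
have := NP (PathSpace xP) N (leqnn N).
rewrite ltr_pdivlMr ?tail_bound_gt0 // mulrC => h1 h2.
rewrite -(subrKA (limit_eigenvalue u z)); apply: le_trans (ler_normD _ _) _.
by rewrite (distrC (limit_eigenvalue u z)); lra.
Qed.

(** * Identification of the omega-spectrum *)

Lemma exists_branching_prefix x n : exists2 k, (n <= k)%N & branching (prefix_of x k).
Proof.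
apply: contrapT => nb.
(* Without branching the mass would stay constant from level [n] on, against its decay like a power
   of [Lambda^-1]. *)
have mP k : mass (prefix_of x (n + k)) = mass (prefix_of x n).
  elim: k => [|k IHk]; first by rewrite addn0.
  rewrite addnS mass_nonbranching //.
  have [//|bx] := branching_prefix x (n + k).
  by case: nb; exists (n + k)%N => //; exact: leq_addr.
have m0 := mass_gt0 (prefix_is_path x n).
have [k kP] : exists k, Lambda^-1 ^+ k < mass (prefix_of x n) / Lambda.
  apply: expr_lt_eps; last exact: divr_gt0.
  by rewrite invr_ge0 (ltW L0) invf_lt1.
move: kP; rewrite -(mP k) ltr_pdivlMr // mulrC ltNge => /negP; apply.
apply: le_trans (mass_le_vol (prefix_is_path x _)) _.
rewrite ler_pM2l //; apply: le_trans (vol_le _) _.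
rewrite size_prefix -exprVn exprD ler_piMl ?exprn_ge0 ?invr_ge0 ?(ltW L0) //.
by rewrite exprn_ile1 ?invr_ge0 ?(ltW L0) // invf_le1 // ltW.
Qed.

(** Deep eigenvalues are uniformly close to values of [limit_eigenvalue], whose range is closed.
    Conversely, every path has branching prefixes of arbitrary depth, with eigenvalues tending to
    its limit. *)
Lemma Sp_omegaE D : (0 < d)%N ->
  is_Laplacian Lambda nu mu (d%:R * (u + 1) + 2) D ->
  Sp_omega mu D = range (limit_eigenvalue u).
Proof.
move=> d0 DP; apply/seteqP; split=> [l lSp|_ [x _ <-] n _].
  apply: limit_eigenvalue_closed_range => e e0.
  have e20 : 0 < e / 2 by rewrite divr_gt0.
  have [N NP] := @exists_V_lt (e / 2 / K') (divr_gt0 e20 tail_bound_gt0).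
  have [l' [[g [Ng bg] gl'] ll']] := lSp N I _ (nbhsx_ballx l (e / 2) e20).
  have El' := acts_by_unique bg gl' (Laplacian_eigen DP bg).
  have [x gx] := cylinder_nonempty bg.1.
  exists x; move: bg; rewrite -gx => bg.
  have := limit_eigenvalue_lambda d0 bg; rewrite gx -El'.
  have := NP x (size g) Ng; rewrite ltr_pdivlMr ?tail_bound_gt0 // mulrC gx => h1 h2.
  rewrite -(subrKA l'); apply: le_lt_trans (ler_normD _ _) _.
  by move: ll'; rewrite /ball /= => h3; rewrite (distrC l'); lra.
move=> B /nbhs_ballP[e /= e0 eB].
have [N NP] := @exists_V_lt (e / K') (divr_gt0 e0 tail_bound_gt0).
have [k kn bk] := exists_branching_prefix x (maxn n N).
move: kn; rewrite geq_max => /andP[nk Nk].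
exists (lambda_ Lambda nu mu (d%:R * (u + 1) + 2) (prefix_of x k)); split.
  by exists (prefix_of x k); [rewrite size_prefix|exact: Laplacian_eigen DP _ bk].
apply: eB; rewrite /ball /=; apply: le_lt_trans (limit_eigenvalue_lambda d0 bk) _.
by have := NP x k Nk; rewrite ltr_pdivlMr ?tail_bound_gt0 // mulrC.
Qed.

End Eigenvalues.

End Masses.

(** * The bi-Hoelder map from the transversal *)

Unset Implicit Arguments.

Theorem corollary5p2 (R : realType) (d m : nat) (S : substitution R d m)
    (Lambda : R) (nu : 'cV[R]_m.+1) (mu : probability (PathT S) R) :
  (1 <= d)%N ->
  primitive_substitution S -> aperiodic_substitution S -> finite_local_complexity S ->
  perron_frobenius_eigenvalue (adjacency S) Lambda ->
  perron_frobenius_eigenvector (adjacency S) Lambda nu ->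
  is_path_measure Lambda nu mu ->
  bilipschitz_homeomorphic (canonical_transversal S) (tiling_dist S)
    [set: path_space S] (path_dist Lambda nu) ->
  (forall p q, (edge_count S p q <= 1)%N) ->
  (forall p q, p != q -> nu p 0 != nu q 0) ->
  exists s_star : R, d%:R + 2 <= s_star /\
    forall s, s_star < s ->
    forall Delta, is_Laplacian Lambda nu mu s Delta ->
      bihoelder_homeomorphic (canonical_transversal S) (tiling_dist S)
        (Sp_omega mu Delta) (fun x y : R => `|x - y|).
Proof.
move=> d0 _ _ _ _ nuP muP [h [k [[hP kP hK kK] [Ch Ch0 hL] [Ck Ck0 kL]]]] simple nu_inj.
have L1 := eigenvalue_gt1 nuP d0; have [_ nu0 nu1] := nuP.
have [K K0 KP] := coef_mass_le L1 nu0 nu1 muP.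
have [c c0 cP] := coef_mass_diff_ge L1 nu0 nu1 muP simple nu_inj.
have [r r01 rP] := vol_branching_contract L1 nu0 nu1 muP.
have /andP[r0 r1] := r01.
have d0' : 0 < d%:R :> R by rewrite ltr0n.
(* For [u > N] this gives [r ^ u * (K + c / 2) <= c / 2], which is [uc] rearranged. The threshold
   below is the [s] that corresponds to [u = N]. *)
have [N NP] : exists N, r ^+ N < (c / 2) / (K + c / 2).
  by apply: expr_lt_eps; [rewrite ltW|rewrite divr_gt0 ?addr_gt0 ?divr_gt0].
exists (d%:R * (N%:R + 1) + 2); split.
  by rewrite lerD2r mulrDr mulr1 lerDr mulr_ge0.
move=> s sN D.
pose u := (s - 2) / d%:R - 1.
have uN : N%:R < u.
  by rewrite /u ltrBrDr ltr_pdivlMr // ltrBrDr mulrC.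
have u0 : 0 < u by apply: le_lt_trans uN.
have -> : s = d%:R * (u + 1) + 2 by rewrite /u subrK mulrC divfK ?subrK // gt_eqF.
move=> DP.
have uc : K / (1 - r `^ u) * r `^ u <= c / 2.
  rewrite mulrAC ler_pdivrMr ?subr_gt0 ?(powR_ratio_lt1 u0 r01) //.
  suff : r `^ u * (K + c / 2) <= c / 2 by lra.
  rewrite -ler_pdivlMr ?addr_gt0 ?divr_gt0 //; apply: le_trans (ltW NP).
  by rewrite -powR_mulrn ?(ltW r0) // ger_powR ?r0 ?ltW.
pose F := limit_eigenvalue Lambda nu mu u : path_space S -> R.
have FP x y := path_dist_bounds L1 nu0 muP u0 KP K0 r01 rP cP uc x y d0.
have Finj : injective F := limit_eigenvalue_inj L1 nu0 muP u0 KP K0 r01 rP c0 cP uc.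
rewrite (Sp_omegaE L1 nu0 nu1 muP u0 KP K0 r01 rP c0 cP uc d0 DP) -/F.
(* Outside the range of [F] the inverse takes an arbitrary value. *)
have /choice[G GP] l : exists x, range F l -> F x = l.
  have [[x _ xl]|nl] := pselect (range F l); first by exists x.
  by exists (path_space_point S).
have GF x : G (F x) = x by apply: Finj; apply: GP; exists x.
pose t := u * d%:R; have t0 : 0 < t by rewrite mulr_gt0.
have pd0 (x y : path_space S) : 0 <= path_dist Lambda nu x y.
  rewrite /path_dist; case: asboolP => // _.
  by rewrite (weightE L1 nu0) ?powR_ge0.
exists (F \o h), (k \o G); split.
- split=> [T XT|l lF|T XT|l lF] /=.
  + by exists (h T).
  + exact: kP.
  + by rewrite GF hK.
  + by rewrite kK // GP.
- have K'0 := tail_bound_gt0 u0 K0 r01.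
  exists (K / (1 - r `^ u) * Ch `^ t), t; split=> //.
    by rewrite mulr_gt0 // powR_gt0.
  move=> T T' XT XT' /=; have /andP[_ le] := FP (h T) (h T').
  apply: le_trans le _; rewrite -[leRHS]mulrA ler_pM2l //.
  have hh := hL _ _ XT XT'.
  (* Nonnegativity follows from the Lipschitz bound, as [path_dist] is nonnegative. *)
  have T0 : 0 <= tiling_dist S T T'.
    by rewrite -(pmulr_rge0 _ Ch0) (le_trans _ hh).
  rewrite -powRM ?(ltW Ch0) //; apply: ge0_ler_powR; rewrite ?nnegrE ?(ltW t0) //.
  by rewrite mulr_ge0 // ltW.
- exists (Ck * (2 / c) `^ t^-1), t^-1; split; rewrite ?invr_gt0 //.
    by rewrite mulr_gt0 // powR_gt0 // divr_gt0.
  move=> l l' lF lF' /=; apply: le_trans (kL _ _ I I) _.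
  rewrite -[leRHS]mulrA ler_pM2l // -powRM ?divr_ge0 ?(ltW c0) //.
  have /andP[le _] := FP (G l) (G l'); rewrite -/F !GP // -/t in le.
  (* This form lets the lower bound on [F], stated for the power [t], yield exponent [t^-1] for the
     inverse. *)
  have E : path_dist Lambda nu (G l) (G l') =
      (path_dist Lambda nu (G l) (G l') `^ t) `^ t^-1.
    by rewrite -powRrM divff ?powRr1 // gt_eqF.
  rewrite E; apply: ge0_ler_powR.
  + by rewrite invr_ge0 ltW.
  + by rewrite nnegrE powR_ge0.
  + by rewrite nnegrE mulr_ge0 ?divr_ge0 // ltW.
  + have -> : 2 / c * `|l - l'| = `|l - l'| / (c / 2) by field; rewrite gt_eqF.
  by rewrite ler_pdivlMr ?divr_gt0 // mulrC.
Qed.
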